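(* Let $t\geq 4$ be an even integer, let $k\geq 1$ be an odd integer, and let $G=D(1,t)$. Then $\mathrm{rl}_k(G)\leq \frac t2 k^2$.
   Context: For a finite set $D=\{d_1<\dots<d_m\}$ of positive integers, the distance graph $D(d_1,\dots,d_m)$ has vertex set $\mathbb{Z}$, two distinct integers $i,j$ being adjacent iff $|i-j|\in D$. For a connected graph $G$ with graph distance $d(\cdot,\cdot)$ and an integer $k\ge 1$, a radio $k$-labeling of $G$ is a map $c:V(G)\to\mathbb{Z}_{\ge 0}$ such that $|c(u)-c(v)|\geq k+1-d(u,v)$ for all distinct vertices $u,v$. Its span is $\max\{c(x)-c(y): x,y\in V(G)\}$ (a supremum for infinite graphs), and the radio $k$-labeling number $\mathrm{rl}_k(G)$ is the minimum span over all radio $k$-labelings of $G$. *)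

(* Defs.v *)
From HB Require Import structures.
From mathcomp Require Import all_boot all_order all_algebra.
From mathcomp Require Import zify.
From mathcomp Require Import boolp classical_sets reals ereal.

Set Implicit Arguments.
Unset Strict Implicit.
Unset Printing Implicit Defensive.

Import Order.TTheory GRing.Theory Num.Theory.
Local Open Scope classical_set_scope.
Local Open Scope ring_scope.

Definition distance_graph (D : seq nat) : rel int :=
  fun i j => (i != j) && (`|i - j|%N \in D).

Definition has_walk (V : Type) (e : rel V) (x y : V) (n : nat) : Prop :=
  exists p : seq V, [/\ path e x p, last x p = y & size p = n].

Definition connected_graph (V : Type) (e : rel V) : Prop :=
  forall x y, exists n, has_walk e x y n.

(* Junk value 0 when y is unreachable from x; the notions below are only
   meant for connected graphs (see distance_graph1_connected). *)
Definition gdist (V : Type) (e : rel V) (x y : V) : nat :=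
  match pselect (exists n, `[< has_walk e x y n >]) with
  | left walkable => ex_minn walkable
  | right _ => 0%N
  end.

Definition radio_labeling (V : Type) (e : rel V) (k : nat) (c : V -> nat) :
    Prop :=
  forall u v, u <> v ->
    k%:Z + 1 - (gdist e u v)%:Z <= `|(c u)%:Z - (c v)%:Z|.

(* +oo when the labels are unbounded *)
Definition span (R : realType) (V : Type) (c : V -> nat) : \bar R :=
  ereal_sup [set z | exists x y, z = ((c x)%:R - (c y)%:R)%:E].

(* The infimum is a minimum: see rl_attained. *)
Definition rl (R : realType) (V : Type) (e : rel V) (k : nat) : \bar R :=
  ereal_inf [set span R c | c in radio_labeling e k].

Lemma gdistP (V : Type) (e : rel V) (x y : V) :
  connected_graph e ->
  has_walk e x y (gdist e x y) /\
  (forall n, has_walk e x y n -> (gdist e x y <= n)%N).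
Proof.
move=> /(_ x y) [n0 w0]; rewrite /gdist; case: pselect => [h|[]]; last first.
  by exists n0; apply/asboolP.
case: ex_minnP => n /asboolP wn min; split=> // m wm; apply: min; exact/asboolP.
Qed.

Lemma distance_graph1_connected (D : seq nat) :
  (1%N \in D) -> connected_graph (distance_graph D).
Proof.
move=> D1.
have up (x : int) n : has_walk (distance_graph D) x (x + n%:Z) n.
  elim: n x => [|n IH] x; first by exists [::]; split=> //=; lia.
  have [p [pp lp sp]] := IH (x + 1).
  exists (x + 1 :: p); split=> //=; [|by rewrite lp; lia|by rewrite sp].
  rewrite pp andbT /distance_graph; apply/andP; split; first lia.
  by rewrite (_ : absz _ = 1%N) //; lia.
have down (x : int) n : has_walk (distance_graph D) x (x - n%:Z) n.
  elim: n x => [|n IH] x; first by exists [::]; split=> //=; lia.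
  have [p [pp lp sp]] := IH (x - 1).
  exists (x - 1 :: p); split=> //=; [|by rewrite lp; lia|by rewrite sp].
  rewrite pp andbT /distance_graph; apply/andP; split; first lia.
  by rewrite (_ : absz _ = 1%N) //; lia.
move=> x y; exists `|x - y|%N; case: (leP x y) => xy.
  by have := up x `|x - y|%N; rewrite (_ : x + _ = y) //; lia.
by have := down x `|x - y|%N; rewrite (_ : x - _ = y) //; lia.
Qed.

Lemma spanP (R : realType) (V : Type) (x0 : V) (c : V -> nat) :
  span R c = +oo%E \/ exists n : nat, span R c = n%:R%:E.
Proof.
have [[N bN]|unb] := pselect (exists N, forall x y, (c x <= c y + N)%N); last first.
  left; apply/eqP; rewrite eq_le leey /=.
  rewrite leNgt; apply/negP => lt.
  have ge0 : (0%:E <= span R c)%E.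
    by apply: ereal_sup_ubound; exists x0, x0; rewrite subrr.
  case E : (span R c) lt ge0 => [r||] // _; rewrite lee_fin => r0.
  apply: unb; exists (Num.truncn r).+1 => x y.
  have : (((c x)%:R - (c y)%:R)%:E <= span R c)%E.
    by apply: ereal_sup_ubound; exists x, y.
  rewrite E lee_fin lerBlDl -(ler_nat R) natrD => /le_trans; apply.
  by rewrite lerD2l ltW // truncnS_gt.
right.
have ex : exists N, `[< forall x y, (c x <= c y + N)%N >] by exists N; apply/asboolP.
case: (ex_minnP ex) => n /asboolP bn min; exists n.
apply/eqP; rewrite eq_le; apply/andP; split.
  apply: ge_ereal_sup => _ [x [y ->]]; rewrite lee_fin lerBlDl -natrD ler_nat.
  exact: bn.
case: n bn min => [|n] bn min.
  by apply: ereal_sup_ubound; exists x0, x0; rewrite subrr.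
have [x [y xy]] : exists x y, ~ (c x <= c y + n)%N.
  apply: contrapT => h; have : (n.+1 <= n)%N; last by rewrite ltnn.
  apply: min; apply/asboolP => x y; apply: contrapT => nxy; apply: h.
  by exists x, y.
apply: ereal_sup_ubound; exists x, y; congr EFin.
have := bn x y; move=> b; have -> : c x = (n.+1 + c y)%N by lia.
by rewrite natrD addrK.
Qed.

Lemma rl_attained (R : realType) (V : Type) (x0 : V) (e : rel V) (k : nat) :
  (exists c, radio_labeling e k c) ->
  exists2 c, radio_labeling e k c & rl R e k = span R c.
Proof.
move=> [c0 rc0].
have [[c [n [rc sc]]]|none] :=
  pselect (exists c (n : nat), radio_labeling e k c /\ span R c = n%:R%:E).
- have ex : exists n, `[< exists2 c, radio_labeling e k c & span R c = n%:R%:E >].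
    by exists n; apply/asboolP; exists c.
  case: (ex_minnP ex) => m /asboolP[c1 rc1 sc1] min; exists c1 => //.
  apply/eqP; rewrite eq_le; apply/andP; split.
    by apply: ereal_inf_lbound; exists c1.
  apply: le_ereal_inf_tmp => _ [c2 rc2 <-]; rewrite sc1.
  have [->|[p sp]] := spanP R x0 c2; first exact: leey.
  by rewrite sp lee_fin ler_nat; apply: min; apply/asboolP; exists c2.
- exists c0 => //.
  have infty c : radio_labeling e k c -> span R c = +oo%E.
    by move=> rc; have [//|[n sn]] := spanP R x0 c; case: none; exists c, n.
  apply/eqP; rewrite eq_le; apply/andP; split.
    by apply: ereal_inf_lbound; exists c0.
  by apply: le_ereal_inf_tmp => _ [c2 rc2 <-]; rewrite !infty.
Qed.

(* Main.v *)
Require Import Defs.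
From mathcomp Require Import all_boot all_order all_algebra.
From mathcomp Require Import boolp classical_sets reals ereal.
From mathcomp Require Import zify ring.

(** Write [t = 2 T] and [M = T k^2 + 1], and label the integers modulo [M] by
    [c (2 m) = - k m] and [c (2 m + 1) = s - k m], with [s] about [M / 2]; the
    span is then at most [M - 1 = (t / 2) k^2]. Two integers at distance [d] differ
    by some [a t + b] with [|a| + |b| <= d] and [|b| <= T], and it is enough that
    [|a| + |b| + |w| > k] for every [w] congruent modulo [M] to the difference of
    their labels.

    If they have the same parity, then [w = k (T X - b / 2) + j] with [j k = X + a].
    For [X > 0] the bound on [b] gives [T X - b / 2 >= 1], so [|a| + |w| <= k] would
    force [j <= - |a|], against [j k > a]. If the parities differ, then
    [2 w = k Z + i] with [i k = Y + 2 a], where [Y] is odd and [Z] is [T Y - b], up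
    to a shift by one. The same argument works unless [|Z| = 1], which is the case
    of displacements near [t k / 2]; there [|b|] makes up for the missing [k]. *)

Import Order.TTheory GRing.Theory Num.Theory.
Local Open Scope ring_scope.

Lemma walk_displacement (T n : nat) (x y : int) : (0 < T)%N ->
  has_walk (distance_graph [:: 1%N; T.*2]) x y n ->
  exists a b : int, [/\ y - x = a * (2 * T%:Z) + b, `|b| <= T%:Z &
    `|a| + `|b| <= n%:Z].
Proof.
move=> T0 [p [+ <- <-]] {n y}.
elim/last_ind: p => [|p z IH] /=.
  by exists 0, 0; split; lia.
rewrite rcons_path last_rcons size_rcons => /andP[/IH[a [b [E bT ab]]]].
rewrite /distance_graph !inE => /andP[_].
set l := last x p in E *.
case/orP => /eqP d; last first.
  have [zl|zl] : z = l + 2 * T%:Z \/ z = l - 2 * T%:Z by lia.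
    by exists (a + 1), b; split; lia.
  by exists (a - 1), b; split; lia.
have [zl|zl] : z = l + 1 \/ z = l - 1 by lia.
  (* At [b = T] the unit step carries, [T + 1 = 2 T + (1 - T)]: [|a|] grows by at most one and [|b|]
     drops by one. *)
  have [b1|b1] := eqVneq b T%:Z; last by exists a, (b + 1); split; lia.
  by exists (a + 1), (1 - T%:Z); split; lia.
have [b1|b1] := eqVneq b (- T%:Z); last by exists a, (b - 1); split; lia.
by exists (a - 1), (T%:Z - 1); split; lia.
Qed.

(** Since [k >= 1], [i * k <= - 2 |a| < Y + 2 a]. *)
Lemma wrap_sign (k a i Y : int) : 1 <= k -> 1 <= Y -> i * k = Y + 2 * a ->
  i <= - (2 * `|a|) -> False.
Proof. by move=> k1 Y1 E ia; nia. Qed.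

Lemma even_gap_pos (T k a b w j : int) : 2 <= T -> 1 <= k ->
  `|2 * b| <= T -> 1 <= j * k - a ->
  w = k * (T * (j * k - a) - b) + j ->
  k < `|a| + `|2 * b| + `|w|.
Proof.
move=> T2 k1 bT; set X := j * k - a => X1 wE.
have Tb : 1 <= T * X - b by nia.
have kTb : k <= k * (T * X - b) by nia.
rewrite ltNge; apply/negP => H.
have ja : j <= - `|a| by lia.
have jk : j * k = X + a by rewrite /X; lia.
by nia.
Qed.

Lemma even_gap (T k a b w j : int) : 2 <= T -> 1 <= k ->
  `|2 * b| <= T -> (a != 0) || (b != 0) ->
  w = k * (T * (j * k - a) - b) + j ->
  k < `|a| + `|2 * b| + `|w|.
Proof.
move=> T2 k1 bT ab wE.
have [X|[X|X]] : 1 <= j * k - a \/ 1 <= (- j) * k - (- a) \/ j * k - a = 0 by lia.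
- exact: even_gap_pos wE.
- have := @even_gap_pos T k (- a) (- b) (- w) (- j) T2 k1.
  have -> : `|2 * - b| = `|2 * b| by lia.
  by rewrite !normrN; apply => //; rewrite wE; ring.
(* Now [a = j k] and [w = j - k b]. If [j = 0], then [b] is nonzero and [|w| >= k]; otherwise
   [|a| >= k] and one of [b], [w] is nonzero. *)
- move: wE; rewrite X mulr0 add0r => wE.
  have aE : a = j * k by lia.
  have [j0|j0] := eqVneq j 0.
    by move: aE wE; rewrite j0 mul0r => a0 wE; nia.
  have ka : k <= `|a| by nia.
  have [b0|b0] := eqVneq b 0; last by lia.
  by rewrite wE b0; lia.
Qed.

(** For [Z >= 2], [wrap_sign] applies. For [Z = 1], [2 a = i k - 1] and [2 w = k + i] with [i]
    nonzero by parity, whence [|a| + |w| >= k]; [|b| >= 1] makes this strict. *)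
Lemma odd_gap_pos (k a b w i Y Z : int) : 1 <= k -> 1 <= Y -> 1 <= `|b| ->
  1 <= Z -> i * k = Y + 2 * a -> 2 * w = k * Z + i -> (Z = 1 -> Y = 1) ->
  k < `|a| + `|b| + `|w|.
Proof.
move=> k1 Y1 b1 Z1 iE wE ZY.
rewrite ltNge; apply/negP => H.
have [Z2|Z2] : 2 <= Z \/ Z = 1 by lia.
  have kZ : 2 * k <= k * Z by nia.
  by apply: (@wrap_sign k a i Y) => //; lia.
have {}iE : i * k = 1 + 2 * a by rewrite iE ZY.
have {}wE : 2 * w = k + i by rewrite wE Z2 mulr1.
have ia : i <= k - 2 - 2 * `|a| by lia.
have [i1|i1] : 1 <= i \/ i <= -1 by lia.
  have : k <= i * k by nia.
  by lia.
have : (- i) + k <= - i * k + 1 by nia.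
by lia.
Qed.

(** Here [2 T] is the original [T]. By parity [|2 b + 1| < 2 T], so [Z] has the sign of [Y], and
    [|Z| = 1] forces [|Y| = 1]. *)
Lemma odd_gap_Teven (T k a b w i y : int) : 1 <= T -> 1 <= k ->
  `|2 * b + 1| <= 2 * T -> i * k = 2 * y + 1 + 2 * a ->
  2 * w = k * (2 * T * (2 * y + 1) - (2 * b + 1)) + i ->
  k < `|a| + `|2 * b + 1| + `|w|.
Proof.
move=> T1 k1 bT iE wE.
have [y0|y0] : 0 <= y \/ y <= -1 by lia.
  by apply: (odd_gap_pos _ _ _ _ _ _ _ k1 _ _ _ iE wE); try lia; nia.
have <- : `|- a| = `|a| by lia.
have <- : `|- (2 * b + 1)| = `|2 * b + 1| by lia.
have <- : `|- w| = `|w| by lia.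
apply: (@odd_gap_pos k _ _ _ (- i) (- (2 * y + 1))
  (- (2 * T * (2 * y + 1) - (2 * b + 1)))) => //; try lia; nia.
Qed.

Lemma odd_gap_Todd (T k a b w i y : int) : 1 <= T -> 1 <= k ->
  `|2 * b + 1| <= 2 * T + 1 -> i * k = 2 * y + 1 + 2 * a ->
  2 * w = k * ((2 * T + 1) * (2 * y + 1) - (2 * b + 1) + 1) + i ->
  k < `|a| + `|2 * b + 1| + `|w|.
Proof.
move=> T1 k1 bT iE wE.
have [y0|y0] : 0 <= y \/ y <= -1 by lia.
  by apply: (odd_gap_pos _ _ _ _ _ _ _ k1 _ _ _ iE wE); try lia; nia.
set Z := (X in k * X) in wE.
have [Z1|Z1] : Z <= -1 \/ Z = 1 by rewrite /Z; nia.
  have <- : `|- a| = `|a| by lia.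
  have <- : `|- (2 * b + 1)| = `|2 * b + 1| by lia.
  have <- : `|- w| = `|w| by lia.
  apply: (@odd_gap_pos k _ _ _ (- i) (- (2 * y + 1)) (- Z)) => //; try lia.
  by rewrite /Z; nia.
(* The shift by one breaks the symmetry: [Z = 1] also occurs for [Y = -1]. There [|a| + |w|] may be
   only [k - 1], but [|2 b + 1| = 2 T + 1 >= 3]. *)
have y1 : y = -1 by move: Z1; rewrite /Z; nia.
have bE : 2 * b + 1 = - (2 * T + 1) by move: Z1; rewrite /Z y1; lia.
rewrite ltNge; apply/negP => H.
have {}wE : 2 * w = k + i by rewrite wE Z1 mulr1.
have {}iE : i * k = 2 * a - 1 by lia.
have ia : i <= k - 6 - 2 * `|a| by lia.
have [i1|i1] : 1 <= i \/ i <= -1 by lia.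
  have : k <= i * k by nia.
  by lia.
have : (- i) + k <= - i * k + 1 by nia.
by lia.
Qed.

(* With this [s], labels at odd displacements near [t k / 2], where they are
   smallest, have absolute value [(k - 1) / 2] or [(k + 1) / 2]. The odd integers
   next to [t k / 2] depend on the parity of [T], hence so does [s]. *)
Lemma half_offset (T k : nat) : (0 < T)%N -> odd k -> exists s : nat,
  (s.*2 + (if odd T then 0 else k) = T * k ^ 2 + 1)%N.
Proof.
move=> T0 k_odd; exists (T * k ^ 2 + 1 - (if odd T then 0 else k))./2%N.
have : odd (T * k ^ 2) = odd T by rewrite oddM oddX k_odd andbT.
case: ifP => oT E; first by lia.
(* The natural subtraction in the witness does not truncate. *)
have : (k <= T * k ^ 2 + 1)%N; last by lia.
by nia.
Qed.

Definition label (T k s : nat) (x : int) : nat :=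
  absz ((s%:Z * (x %% 2)%Z - k%:Z * (x %/ 2)%Z) %% (T * k ^ 2).+1%:Z)%Z.

Lemma label_bound (T k s : nat) (x : int) : (label T k s x <= T * k ^ 2)%N.
Proof.
by rewrite /label; set M := (T * k ^ 2)%N; set z := _ - _; lia.
Qed.

Lemma label_congr (T k s : nat) (x : int) : exists j : int,
  (label T k s x)%:Z =
  s%:Z * (x %% 2)%Z - k%:Z * (x %/ 2)%Z + j * (T%:Z * k%:Z ^+ 2 + 1).
Proof.
rewrite /label; set z := _ - _.
have -> : T%:Z * k%:Z ^+ 2 + 1 = (T * k ^ 2).+1%:Z by lia.
set M := (T * k ^ 2)%N.
exists (- (z %/ M.+1%:Z)%Z); have := divz_eq z M.+1%:Z.
have : 0 <= (z %% M.+1%:Z)%Z by rewrite modz_ge0.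
by move=> m0 E; rewrite gez0_abs // mulNr [X in X - _]E addrAC subrr add0r.
Qed.

Lemma label_gap_even (T k : nat) (a b w j x : int) : (2 <= T)%N -> (0 < k)%N ->
  `|b| <= T%:Z -> (a != 0) || (b != 0) ->
  a * (2 * T%:Z) + b = 2 * x ->
  w = - (k%:Z * x) + j * (T%:Z * k%:Z ^+ 2 + 1) ->
  k%:Z < `|a| + `|b| + `|w|.
Proof.
move=> T2 k0 bT ab nE wE.
have bE : b = 2 * (x - a * T%:Z) by lia.
rewrite bE; apply: (even_gap T%:Z k%:Z a _ w j) => //; lia.
Qed.

Lemma label_gap_odd (T k s : nat) (a b w j x : int) : (2 <= T)%N -> odd k ->
  (s.*2 + (if odd T then 0 else k) = T * k ^ 2 + 1)%N ->
  `|b| <= T%:Z -> a * (2 * T%:Z) + b = 2 * x + 1 ->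
  w = s%:Z - k%:Z * x + j * (T%:Z * k%:Z ^+ 2 + 1) ->
  k%:Z < `|a| + `|b| + `|w|.
Proof.
move=> T2 k_odd sE bT nE wE.
have bE : b = 2 * (x - a * T%:Z) + 1 by lia.
set c := x - a * T%:Z in bE.
have xE : x = a * T%:Z + c by rewrite /c; ring.
have [l kE] : exists l : nat, k = l.*2.+1 by exists k./2; lia.
(* Doubling turns [s + j M] into [(2 j + 1) M], less [k] when [T] is even; so [2 j + 1] serves as
   [i] and [2 y + 1] as [Y]. *)
pose y := l%:Z * (2 * j + 1) + j - a.
have iE : (2 * j + 1) * k%:Z = 2 * y + 1 + 2 * a by rewrite /y kE; lia.
have w2 : 2 * w = 2 * s%:Z - k%:Z * (2 * x) + 2 * j * (T%:Z * k%:Z ^+ 2 + 1).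
  by rewrite wE; ring.
have yE : 2 * y + 1 = (2 * j + 1) * k%:Z - 2 * a by lia.
rewrite bE in bT *.
have [oT|oT] := boolP (odd T).
  have [r TE] : exists r : nat, T = r.*2.+1 by exists T./2; lia.
  have T2E : 2 * r%:Z + 1 = T%:Z by lia.
  apply: (@odd_gap_Todd r%:Z k%:Z a c w (2 * j + 1) y); try lia.
  have sE' : 2 * s%:Z = T%:Z * k%:Z ^+ 2 + 1.
    by move: sE; rewrite oT => sE; lia.
  by rewrite w2 sE' yE T2E xE; ring.
have [r TE] : exists r : nat, T = r.*2 by exists T./2; lia.
have T2E : 2 * r%:Z = T%:Z by lia.
apply: (@odd_gap_Teven r%:Z k%:Z a c w (2 * j + 1) y); try lia.
have sE' : 2 * s%:Z = T%:Z * k%:Z ^+ 2 + 1 - k%:Z.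
  by move: sE; rewrite (negbTE oT) => sE; lia.
by rewrite w2 sE' yE T2E xE; ring.
Qed.

Lemma label_radio (T k s : nat) : (2 <= T)%N -> odd k ->
  (s.*2 + (if odd T then 0 else k) = T * k ^ 2 + 1)%N ->
  radio_labeling (distance_graph [:: 1%N; T.*2]) k (label T k s).
Proof.
move=> T2 k_odd sE u v uv.
have [walk _] := gdistP u v (@distance_graph1_connected [:: 1%N; T.*2] isT).
have T0 : (0 < T)%N by lia.
have k0 : (0 < k)%N by lia.
have [a [b [nE bT ab]]] := walk_displacement _ _ _ _ T0 walk.
move: (gdist _ _ _) ab {walk} => d ab.
suff : k%:Z < `|a| + `|b| + `|(label T k s u)%:Z - (label T k s v)%:Z| by lia.
have [j cu] := label_congr T k s u.
have [l cv] := label_congr T k s v.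
have ab0 : (a != 0) || (b != 0).
  apply/negP => /negP; rewrite negb_or !negbK => /andP[/eqP a0 /eqP b0].
  by apply: uv; move: nE; rewrite a0 b0; lia.
have uE := divz_eq u 2; have vE := divz_eq v 2.
rewrite cu cv; move: cu cv => _ _.
have : (u %% 2)%Z = 0 \/ (u %% 2)%Z = 1 by lia.
have : (v %% 2)%Z = 0 \/ (v %% 2)%Z = 1 by lia.
set p := (u %/ 2)%Z in uE *; set q := (v %/ 2)%Z in vE *.
move=> [v2|v2] [u2|u2]; rewrite u2 in uE *; rewrite v2 in vE *.
- rewrite distrC.
  by apply: (label_gap_even T k a b _ (l - j) (q - p)) => //; [lia|ring].
(* With [u] odd and [v] even, the displacement is negated to get the form [2 x + 1] with
   [x = p - q]. *)
- have <- : `|- a| = `|a| by lia.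
  have <- : `|- b| = `|b| by lia.
  by apply: (label_gap_odd T k s _ _ _ (j - l) (p - q)) => //; [lia|lia|ring].
- rewrite distrC.
  by apply: (label_gap_odd T k s a b _ (l - j) (q - p)) => //; [lia|ring].
- rewrite distrC.
  by apply: (label_gap_even T k a b _ (l - j) (q - p)) => //; [lia|ring].
Qed.

Theorem theorem5 (R : realType) (t k : nat)
    (ht : (4 <= t)%N) (t_even : ~~ odd t) (hk : (1 <= k)%N) (k_odd : odd k) :
  (rl R (distance_graph [:: 1%N; t]) k <= (t%:R / 2%:R * k%:R ^+ 2)%:E)%E.
Proof.
have [T tE] : exists T : nat, t = T.*2 by exists t./2; lia.
have T2 : (2 <= T)%N by lia.
have [s sE] := @half_offset T k (ltnW T2) k_odd.
apply: (@le_trans _ _ (Defs.span R (label T k s))).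
  apply: ereal_inf_lbound; exists (label T k s) => //.
  by rewrite tE; exact: label_radio.
apply: ge_ereal_sup => _ [x [y ->]]; rewrite lee_fin.
have -> : t%:R / 2%:R * k%:R ^+ 2 = (T * k ^ 2)%:R :> R.
  by rewrite tE -muln2 (natrM _ T 2) (natrM _ T (k ^ 2)) natrX mulfK // pnatr_eq0.
rewrite lerBlDr -natrD ler_nat.
by apply: (leq_trans (label_bound T k s x)); rewrite leq_addr.
Qed.
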